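(* Let $s\ge 3$ and $\rho$ be integers such that $s-1\le \rho\le s^2-s-3$. There is no $[\rho s,s;3]$-bigraph whose order attains the Moore bound $M(\rho s,s;3)=(s^2-1)(\rho+1)$. Instead, the following improved Moore bound holds: every $[\rho s,s;3]$-bigraph has at most $$M^*(\rho s,s;3)=(s^2-2)(\rho+1)$$ vertices, this value corresponding to part sizes $N_1=s^2-2$ and $N_2=\rho(s^2-2)$.
   Context: Graphs are finite and simple. An $[r,s;d]$-bigraph is a bipartite graph $G=(V,E)$ with stable sets (parts) $V=V_1\cup V_2$, in which every vertex of $V_1$ has degree $r$, every vertex of $V_2$ has degree $s$, and the diameter is $d$. Write $N_i=|V_i|$ for $i=1,2$; the order of $G$ is $N_1+N_2$. For $r\ge s$, the Moore bound for diameter $3$ is $$M(r,s;3)=\left\lfloor \frac{1+s(r-1)}{\rho'}\right\rfloor(\rho'+\sigma'),\qquad \rho'=\frac{r}{\gcd(r,s)},\quad \sigma'=\frac{s}{\gcd(r,s)},$$ which is an upper bound on the order of any $[r,s;3]$-bigraph. For $r=\rho s$ with $\rho\ge s-1$ it equals $(s^2-1)(\rho+1)$, corresponding to $N_1=s^2-1$, $N_2=\rho(s^2-1)$. The improved bound is an upper bound; no claim is made that it is attained. *)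

(* Defs.v *)
From mathcomp Require Import all_boot.
Set Implicit Arguments.
Unset Strict Implicit.
Unset Printing Implicit Defensive.

(* A finite simple graph is a symmetric irreflexive relation on a finType.   *)

Definition degree (T : finType) (e : rel T) (x : T) : nat := #|[set y | e x y]|.

Definition stable (T : finType) (e : rel T) (A : {set T}) : Prop :=
  {in A &, forall x y, ~~ e x y}.

(* n is the length of a shortest path from x to y; no n qualifies when x and *)
(* y lie in different components.                                            *)
Definition is_dist (T : finType) (e : rel T) (x y : T) (n : nat) : Prop :=
  (exists p : seq T, [/\ path e x p, last x p = y & size p = n]) /\
  (forall p : seq T, path e x p -> last x p = y -> n <= size p).

(* In particular, a graph with a diameter is connected and nonempty.         *)
Definition has_diameter (T : finType) (e : rel T) (d : nat) : Prop :=
  (forall x y : T, exists2 n, is_dist e x y n & n <= d) /\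
  (exists x y : T, is_dist e x y d).

Record bigraph (r s d : nat) (T : finType) (e : rel T) (V1 V2 : {set T})
    : Prop := Bigraph {
  bigraph_sym : symmetric e;
  bigraph_irr : irreflexive e;
  bigraph_cover : V1 :|: V2 = [set: T];
  bigraph_disjoint : [disjoint V1 & V2];
  bigraph_stable1 : stable e V1;
  bigraph_stable2 : stable e V2;
  bigraph_degree1 : {in V1, forall x, degree e x = r};
  bigraph_degree2 : {in V2, forall x, degree e x = s};
  bigraph_diameter : has_diameter e d
}.

(* M(r,s;3), meant for r >= s; the floor is Euclidean division.              *)
Definition moore_bound3 (r s : nat) : nat :=
  let rho' := r %/ gcdn r s in
  let sigma' := s %/ gcdn r s in
  (1 + s * (r - 1)) %/ rho' * (rho' + sigma').

(* M*(rho s, s; 3). *)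
Definition improved_moore_bound3 (rho s : nat) : nat :=
  (s ^ 2 - 2) * (rho + 1).

(* Main.v *)
(* View V1 as points and V2 as blocks: each point lies on r = rho s blocks, each
   block has s points, and diameter 3 forces any two blocks to meet. So the
   matrix C with entries |b n c| - 1 is nonnegative, with constant row sums
   k = r s - N2, and its quadratic form is at most k |y|^2. For distinct points
   p, q on l common blocks, let y be the difference of the indicators of the
   blocks through p and through q. As y sums to 0, y^T C y is the squared norm of
   the point vector induced by y, whose entries at p and q are r - l and l - r;
   hence 2 (r - l)^2 <= k * 2 (r - l), so l >= r - k. Summing over q gives
   (N1 - 1) (r + N2 - r s) <= r (s - 1), which for N2 = rho N1 reads
   N1 <= s^2 - s + 1, and this is at most s^2 - 2. *)
Require Import Defs.
From mathcomp Require Import all_boot.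
From mathcomp Require Import all_order all_algebra.
From mathcomp Require Import zify ring lra.
Import Order.TTheory GRing.Theory Num.Theory.

Local Open Scope ring_scope.

(** Sum [2 * y b * y c <= y b ^+ 2 + y c ^+ 2] against the nonnegative weights: the squares
    contribute [k * |y|^2] once by rows and once, by symmetry, by columns. *)
Lemma quad_form_le_row_sum (R : realDomainType) (I : finType) (B : {set I})
    (C : I -> I -> R) (k : R) (y : I -> R) :
  {in B &, forall b c, 0 <= C b c} -> {in B &, forall b c, C b c = C c b} ->
  {in B, forall b, \sum_(c in B) C b c = k} ->
  \sum_(b in B) \sum_(c in B) y b * y c * C b c <= k * \sum_(b in B) y b ^+ 2.
Proof.
move=> C_ge0 C_sym C_row; set S := (X in X <= _).
have row : \sum_(b in B) \sum_(c in B) y b ^+ 2 * C b c =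
    k * \sum_(b in B) y b ^+ 2.
  by rewrite mulr_sumr; apply: eq_bigr => b bB; rewrite -mulr_sumr C_row // mulrC.
have col : \sum_(b in B) \sum_(c in B) y c ^+ 2 * C b c =
    k * \sum_(b in B) y b ^+ 2.
  rewrite exchange_big -row; apply: eq_bigr => b bB.
  by apply: eq_bigr => c cB; rewrite C_sym.
(* Doubling avoids halving, as [R] need not be a field. *)
suff : S + S <= k * (\sum_(b in B) y b ^+ 2) + k * (\sum_(b in B) y b ^+ 2) by lra.
rewrite -{1}row -col /S -!big_split /=; apply: ler_sum => b bB.
rewrite -!big_split /=; apply: ler_sum => c cB.
rewrite -!mulrDl ler_wpM2r ?C_ge0 //.
by have := sqr_ge0 (y b - y c); lra.
Qed.

Lemma card_nbh_sum (T : finType) (e : rel T) (A : {set T}) (x : T) :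
  #|[set y in A | e x y]|%:Z = \sum_(y in A) (e x y)%:Z.
Proof.
rewrite -sum1_card (big_morph Posz PoszD (erefl _)).
under eq_bigl do rewrite inE.
rewrite big_mkcondr /=; apply: eq_bigr => y _; by case: (e x y).
Qed.

(** This is [l >= r - k], stated over the integers because its left side may be negative. *)
Lemma pair_degree_lower_bound (T : finType) (I : rel T) (P B : {set T})
    (r s : int) (p q : T) :
  {in P, forall z, \sum_(b in B) (I z b)%:Z = r} ->
  {in B, forall b, \sum_(z in P) (I z b)%:Z = s} ->
  {in B &, forall b c, exists2 z, z \in P & I z b && I z c} ->
  (0 < #|B|)%N -> p \in P -> q \in P -> p != q ->
  r + #|B|%:Z - r * s <= \sum_(b in B) (I p b)%:Z * (I q b)%:Z.
Proof.
move=> degP degB meet Bn0 pP qP npq.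
set l := (X in _ <= X); pose k : int := r * s - #|B|%:Z.
pose C b c : int := \sum_(z in P) (I z b)%:Z * (I z c)%:Z - 1.
have C_ge0 : {in B &, forall b c, 0 <= C b c}.
  move=> b c bB cB; rewrite /C subr_ge0; have [z zP /andP[zb zc]] := meet b c bB cB.
  by rewrite (bigD1 z) //= zb zc mulr1 lerDl; apply: sumr_ge0 => i _; apply: mulr_ge0.
have C_sym : {in B &, forall b c, C b c = C c b}.
  by move=> b c _ _; rewrite /C; under eq_bigr do rewrite mulrC.
(* Each of the [s] points of [b] lies on [r] blocks; the subtracted ones total [#|B|]. *)
have C_row : {in B, forall b, \sum_(c in B) C b c = k}.
  move=> b bB; rewrite /C sumrB exchange_big /= /k sumr_const pmulrn intz.
  congr (_ - _); rewrite mulrC -(degB b bB) mulr_suml.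
  by apply: eq_bigr => z zP; rewrite -mulr_sumr degP.
(* A row sum of nonnegative entries, once some block exists; this settles the case [r <= l] at the
   end. *)
have k_ge0 : 0 <= k.
  have /card_gt0P[b bB] := Bn0.
  by rewrite -(C_row b bB); apply: sumr_ge0 => c cB; apply: C_ge0.
pose y b : int := (I p b)%:Z - (I q b)%:Z.
have idem (a : bool) : a%:Z * a%:Z = a%:Z by case: a.
have y_sum0 : \sum_(b in B) y b = 0 by rewrite /y sumrB !degP ?subrr.
have y_norm : \sum_(b in B) y b ^+ 2 = (r - l) * 2.
  transitivity (\sum_(b in B) (I p b)%:Z + \sum_(b in B) (I q b)%:Z - l * 2).
    rewrite /l mulr_suml -big_split -sumrB /=; apply: eq_bigr => b _.
    by rewrite -{1}(idem (I p b)) -{1}(idem (I q b)) /y; ring.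
  by rewrite !degP //; ring.
pose f z : int := \sum_(b in B) y b * (I z b)%:Z.
have fp : f p = r - l.
  rewrite /f /l -(degP p pP) -sumrB; apply: eq_bigr => b _.
  by rewrite /y mulrBl idem; ring.
have fq : f q = l - r.
  rewrite /f /l -(degP q qP) -sumrB; apply: eq_bigr => b _.
  by rewrite /y mulrBl idem; ring.
have f_norm : \sum_(z in P) f z ^+ 2 =
    \sum_(b in B) \sum_(c in B) y b * y c * C b c.
  (* [C + 1] is the Gram matrix of the block indicators, and the all-ones correction is the square
     of the sum of [y], which vanishes. *)
  transitivity (\sum_(b in B) \sum_(c in B) y b * y c * (C b c + 1) -
                \sum_(b in B) y b * \sum_(c in B) y c); last first.
    rewrite -sumrB; apply: eq_bigr => b _; rewrite mulr_sumr -sumrB.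
    by apply: eq_bigr => c _; ring.
  rewrite y_sum0 [X in _ - X]big1 ?subr0; last by move=> *; rewrite mulr0.
  transitivity (\sum_(z in P) \sum_(b in B) \sum_(c in B)
                  y b * y c * ((I z b)%:Z * (I z c)%:Z)).
    apply: eq_bigr => z _; rewrite expr2 /f mulr_suml; apply: eq_bigr => b _.
    by rewrite mulr_sumr; apply: eq_bigr => c _; ring.
  rewrite exchange_big; apply: eq_bigr => b _.
  rewrite exchange_big; apply: eq_bigr => c _.
  by rewrite /C subrK mulr_sumr.
(* Only the squares at [p] and [q] are kept. *)
have f_ge : (r - l) ^+ 2 * 2 <= \sum_(z in P) f z ^+ 2.
  rewrite (bigD1 p) //= (bigD1 q) /= ?qP 1?eq_sym // fp fq.
  set w := (\sum_(i | _) _); have : 0 <= w by apply: sumr_ge0 => *; apply: sqr_ge0.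
  by lia.
have := quad_form_le_row_sum _ _ _ _ _ y C_ge0 C_sym C_row.
rewrite -f_norm y_norm => f_le.
have : (r - l) ^+ 2 <= k * (r - l) by lia.
rewrite expr2 -/k => quad.
suff : r - l <= k by rewrite /k; lia.
have [a_le0|a_gt0] := lerP (r - l) 0; first exact: le_trans k_ge0.
by rewrite -(ler_pM2r a_gt0).
Qed.

(** Each of the [r] blocks through a fixed [p] holds [s - 1] further points, so the common-block
    counts of [p] with all [q != p] total [r * (s - 1)]. *)
Lemma intersecting_design_bound (T : finType) (I : rel T) (P B : {set T})
    (r s : int) :
  {in P, forall z, \sum_(b in B) (I z b)%:Z = r} ->
  {in B, forall b, \sum_(z in P) (I z b)%:Z = s} ->
  {in B &, forall b c, exists2 z, z \in P & I z b && I z c} ->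
  (0 < #|P|)%N -> (0 < #|B|)%N ->
  (#|P|%:Z - 1) * (r + #|B|%:Z - r * s) <= r * (s - 1).
Proof.
move=> degP degB meet /card_gt0P[p pP] Bn0.
have -> : r * (s - 1) =
    \sum_(q in P | q != p) \sum_(b in B) (I p b)%:Z * (I q b)%:Z.
  rewrite exchange_big /= -{1}(degP p pP) mulr_suml; apply: eq_bigr => b bB.
  rewrite -mulr_sumr -(degB b bB) [in LHS](bigD1 p) //=.
  by case: (I p b); rewrite ?mul0r // addrC addrK.
have -> : (#|P|%:Z - 1) * (r + #|B|%:Z - r * s) =
    \sum_(q in P | q != p) (r + #|B|%:Z - r * s).
  rewrite sumr_const -mulr_natl; congr (_ * _).
  rewrite (cardD1 p P) pP PoszD [1%:Z + _]addrC addrK natz.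
  by congr Posz; apply: eq_card => x; rewrite !inE andbC.
apply: ler_sum => q /andP[qP npq].
by apply: (pair_degree_lower_bound _ _ _ _ _ _ _ _ degP degB meet); rewrite // eq_sym.
Qed.

(** Vertices of one part are at even distance, here 0 or 2. At distance 2 the middle vertex serves;
    if [b = c], any neighbor does, and [0 < s] supplies one. *)
Lemma bigraph_common_neighbor (r s : nat) (T : finType) (e : rel T)
    (V1 V2 : {set T}) (b c : T) :
  (0 < s)%N -> bigraph r s 3 e V1 V2 -> b \in V2 -> c \in V2 ->
  exists2 z, z \in V1 & e z b && e z c.
Proof.
move=> s_gt0 [e_sym _ cover disj st1 st2 _ deg2 [dist _]] bV cV.
have nbhV1 x y : x \in V2 -> e x y -> y \in V1.
  move=> xV xy; have: y \in V1 :|: V2 by rewrite cover inE.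
  by case/setUP => // yV; have := st2 x y xV yV; rewrite xy.
have nbhV2 x y : x \in V1 -> e x y -> y \in V2.
  move=> xV xy; have: y \in V1 :|: V2 by rewrite cover inE.
  by case/setUP => // yV; have := st1 x y xV yV; rewrite xy.
have [n [[p [pp last_p <-]] _] sz_p] := dist b c.
move: cV; rewrite -last_p {last_p} => cV.
case: p pp sz_p cV => [|x [|y [|z [|t p]]]] //=.
- move=> _ _ _; have /card_gt0P[z] : (0 < degree e b)%N by rewrite deg2.
  by rewrite inE => bz; exists z; rewrite ?(nbhV1 b) // e_sym bz.
- by rewrite andbT => bx _ xV; have := st2 b x bV xV; rewrite bx.
- by rewrite andbT => /andP[bx xy] _ _; exists x; rewrite ?(nbhV1 b) // e_sym bx.
- rewrite andbT => /and3P[bx xy yz] _ zV.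
  have zV1 : z \in V1 by apply: (nbhV1 y) yz; apply: nbhV2 xy; apply: nbhV1 bx.
  by have := disjointFr disj zV1; rewrite zV.
Qed.

Lemma bigraph_degree_sum (r s d : nat) (T : finType) (e : rel T)
    (V1 V2 : {set T}) :
  bigraph r s d e V1 V2 ->
  {in V1, forall z, \sum_(b in V2) (e z b)%:Z = r%:Z} /\
  {in V2, forall b, \sum_(z in V1) (e z b)%:Z = s%:Z}.
Proof.
case=> [e_sym _ cover disj st1 st2 deg1 deg2 _].
have coverP x : (x \in V1) || (x \in V2) by rewrite -in_setU cover inE.
split=> [z zV|b bV].
  rewrite -card_nbh_sum -(deg1 z zV); congr Posz; apply: eq_card => b.
  rewrite !inE; have := coverP b; case: (b \in V2) => //=; rewrite orbF => bV.
  by apply/esym/negbTE/st1.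
under eq_bigr do rewrite e_sym.
rewrite -card_nbh_sum -(deg2 b bV); congr Posz; apply: eq_card => z.
rewrite !inE; have := coverP z; case: (z \in V1) => //= zV.
by apply/esym/negbTE/st2.
Qed.

Lemma bigraph_parts_card (rho s d : nat) (T : finType) (e : rel T)
    (V1 V2 : {set T}) :
  (0 < s)%N -> bigraph (rho * s) s d e V1 V2 ->
  #|V2| = (rho * #|V1|)%N /\ #|T| = (#|V1| * (rho + 1))%N.
Proof.
move=> s_gt0 G; have [deg1 deg2] := bigraph_degree_sum _ _ _ _ _ _ _ G.
have cardT : #|T| = (#|V1| + #|V2|)%N.
  case: G => [_ _ cover disj _ _ _ _ _].
  by rewrite -cardsT -cover cardsU; move: disj; rewrite -setI_eq0 => /eqP->;
     rewrite cards0 subn0.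
(* The edges are counted from each part. *)
have edges : \sum_(z in V1) (rho * s)%:Z = \sum_(b in V2) s%:Z.
  under eq_bigr => z zV do rewrite -(deg1 z zV).
  by rewrite exchange_big; apply: eq_bigr => b bV; rewrite deg2.
have V2E : #|V2| = (rho * #|V1|)%N.
  move: edges; rewrite !sumr_const -[_ *+ #|V1|]mulr_natr -[_ *+ #|V2|]mulr_natr.
  rewrite !natz -!PoszM => -[edges].
  by apply/eqP; rewrite -(eqn_pmul2l s_gt0) -edges; apply/eqP; lia.
by rewrite cardT V2E; lia.
Qed.

(* s^2 - s + 1 is the number of points of a projective plane of order s - 1. *)
Lemma bigraph_part1_bound (rho s : nat) (T : finType) (e : rel T)
    (V1 V2 : {set T}) :
  (1 < s)%N -> (0 < rho)%N -> bigraph (rho * s) s 3 e V1 V2 ->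
  (#|V1| <= s ^ 2 - s + 1)%N.
Proof.
move=> s_gt1 rho_gt0 G; have s_gt0 := ltnW s_gt1.
have [deg1 deg2] := bigraph_degree_sum _ _ _ _ _ _ _ G.
have [V2E _] := bigraph_parts_card _ _ _ _ _ _ _ s_gt0 G.
have [->//|V1_gt0] := posnP #|V1|.
have V2_gt0 : (0 < #|V2|)%N by rewrite V2E muln_gt0 rho_gt0.
have meet : {in V2 &, forall b c, exists2 z, z \in V1 & e z b && e z c}.
  by move=> b c; apply: bigraph_common_neighbor G.
have := intersecting_design_bound _ _ _ _ _ _ deg1 deg2 meet V1_gt0 V2_gt0.
rewrite V2E; move: #|V1| V1_gt0 => v v_gt0.
(* Both sides carry a factor [rho], which cancels. *)
have -> : (v%:Z - 1) * ((rho * s)%:Z + (rho * v)%:Z - (rho * s)%:Z * s%:Z) =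
    rho%:Z * ((v%:Z - 1) * (s%:Z + v%:Z - s%:Z * s%:Z)) by rewrite !PoszM; ring.
have -> : (rho * s)%:Z * (s%:Z - 1) = rho%:Z * (s%:Z * (s%:Z - 1)).
  by rewrite PoszM mulrA.
rewrite ler_pM2l; last by lia.
(* Equality holds at [v = s^2 - s + 1]; for larger [v] both factors on the left grow, breaking the
   bound. *)
move=> bound; rewrite leqNgt; apply/negP => v_big.
have : (s%:Z * s%:Z - s%:Z + 2 <= v%:Z) by nia.
by nia.
Qed.

(** Here [rho' = rho] and [sigma' = 1]. Dividing by [rho] leaves remainder [rho + 1 - s], which is
    nonnegative by [s - 1 <= rho] and below [rho] by [1 < s]. *)
Lemma moore_bound3_multiple (s rho : nat) :
  (1 < s)%N -> (s - 1 <= rho)%N ->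
  moore_bound3 (rho * s) s = ((s ^ 2 - 1) * (rho + 1))%N.
Proof.
move=> s_gt1 le_rho; have s_gt0 := ltnW s_gt1; have rho_gt0 : (0 < rho)%N by lia.
rewrite /moore_bound3 gcdnC gcdnMl mulnK // divnn s_gt0; congr (_ * _)%N.
have -> : (1 + s * (rho * s - 1) = (s ^ 2 - 1) * rho + (rho + 1 - s))%N.
  by nia.
by rewrite divnMDl // divn_small ?addn0 //; lia.
Qed.

Local Close Scope ring_scope.

Theorem proposition1p3 (s rho : nat) (hs : 3 <= s)
    (hrho_lo : s - 1 <= rho) (hrho_hi : rho <= s ^ 2 - s - 3) :
  [/\ moore_bound3 (rho * s) s = (s ^ 2 - 1) * (rho + 1),
      ~ (exists (T : finType) (e : rel T) (V1 V2 : {set T}),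
           bigraph (rho * s) s 3 e V1 V2 /\ #|T| = moore_bound3 (rho * s) s),
      forall (T : finType) (e : rel T) (V1 V2 : {set T}),
        bigraph (rho * s) s 3 e V1 V2 ->
        #|T| <= improved_moore_bound3 rho s,
      improved_moore_bound3 rho s = (s ^ 2 - 2) + rho * (s ^ 2 - 2)
    & forall (T : finType) (e : rel T) (V1 V2 : {set T}),
        bigraph (rho * s) s 3 e V1 V2 ->
        (#|T| = improved_moore_bound3 rho s <->
         #|V1| = s ^ 2 - 2 /\ #|V2| = rho * (s ^ 2 - 2))].
Proof.
have s_gt0 : 0 < s by lia.
have s_gt1 : 1 < s by lia.
have rho_gt0 : 0 < rho by lia.
have part1 (T : finType) (e : rel T) (V1 V2 : {set T}) :
    bigraph (rho * s) s 3 e V1 V2 -> #|V1| <= s ^ 2 - 2.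
  (* [s^2 - s + 1 <= s^2 - 2] amounts to [3 <= s]. *)
  by move=> /(bigraph_part1_bound _ _ _ _ _ _ s_gt1 rho_gt0); lia.
have order (T : finType) (e : rel T) (V1 V2 : {set T}) :
    bigraph (rho * s) s 3 e V1 V2 -> #|T| <= improved_moore_bound3 rho s.
  move=> G; have [_ ->] := bigraph_parts_card _ _ _ _ _ _ _ s_gt0 G.
  by rewrite leq_mul2r (part1 _ _ _ _ G) orbT.
have moore := moore_bound3_multiple _ _ s_gt1 hrho_lo.
split=> // [[T [e [V1 [V2 [G cardT]]]]]||T e V1 V2 G].
- have := order _ _ _ _ G; rewrite cardT moore /improved_moore_bound3.
  by rewrite leq_pmul2r ?addn1 //; nia.
- by rewrite /improved_moore_bound3; lia.
(* The order and [#|V2|] are both determined by [#|V1|], so it remains to cancel [rho + 1]. *)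
have [-> ->] := bigraph_parts_card _ _ _ _ _ _ _ s_gt0 G.
split=> [/eqP|[-> _] //].
by rewrite eqn_pmul2r ?addn1 // => /eqP ->.
Qed.
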